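(* For every even positive integer $n$, $$f'(n)\le g(n)\le f(n)\le p(n).$$
   Context: For a partition $\lambda=\{d_1\ge d_2\ge\cdots\ge d_\ell\}$ of $n$ (positive integer parts with sum $n$), let $k$ be the number of indices $m$ with $d_m\ge m$ (the length of the main diagonal of the Ferrers diagram of $\lambda$). The Frobenius partition of $\lambda$ is the two-row array $\begin{pmatrix} a_1&a_2&\cdots&a_k\\ b_1&b_2&\cdots&b_k\end{pmatrix}$, where for $1\le m\le k$, $a_m=d_m-m$ is the number of cells of row $m$ of the Ferrers diagram strictly to the right of the diagonal, and $b_m$ is the number of cells of column $m$ strictly below the diagonal; equivalently $b_m=\frac{m(m-1)}{2}+\sum_{i=m+1}^{\ell}\min\{m,d_i\}-\sum_{i=1}^{m-1}b_i$. Partitions of $n$ correspond bijectively to Frobenius partitions of weight $n$. Definitions of the four counting functions: - $p(n)$ is the number of integer partitions of $n$. - $g(n)$ is the number of graphical partitions of $n$, i.e. partitions of $n$ whose parts are the vertex degrees of some simple undirected graph. - $f(n)$ is the number of partitions of $n$ whose Frobenius partition satisfies $k+\sum_{i=1}^{k}a_i\le\sum_{i=1}^{k}b_i$. - $f'(n)$ is the number of partitions of $n$ whose Frobenius partition satisfies $a_m-b_m\le -1$ for each $1\le m\le k$. *)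

(* Defs.v *)
From mathcomp Require Import all_boot ssralg orderedzmod ssrint.

Set Implicit Arguments.
Unset Strict Implicit.
Unset Printing Implicit Defensive.

Definition is_partition (n : nat) (d : seq nat) : bool :=
  [&& sorted geq d, 0 \notin d & sumn d == n].

(* A partition of n has at most n parts, each at most n, so partitions of n are
   counted inside the finite type of sequences of length <= n over {0,...,n};
   partition_bseq below shows that none is missed. *)
Definition count_partitions (n : nat) (P : pred (seq nat)) : nat :=
  #|[set s : n.-bseq 'I_n.+1 |
      is_partition n (map val s) && P (map val s)]|.

Lemma partition_bseq (n : nat) (d : seq nat) :
  is_partition n d -> exists s : n.-bseq 'I_n.+1, map val s = d.
Proof.
case/and3P=> _ d0 /eqP dn.
have szd : size d <= n.
  rewrite -dn; elim: d d0 {dn} => //= x d IHd.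
  rewrite inE negb_or eq_sym -lt0n => /andP[x0 /IHd].
  by move=> ?; rewrite -add1n leq_add.
have led x : x \in d -> x < n.+1.
  rewrite ltnS -dn; elim: d {d0 dn szd} => //= y d IHd.
  rewrite inE => /orP[/eqP->|/IHd]; first exact: leq_addr.
  by move/leq_trans; apply; apply: leq_addl.
have szs : size (map (@inord n) d) <= n by rewrite size_map.
exists (Bseq szs) => /=; rewrite -map_comp -[RHS]map_id.
by apply/eq_in_map => x xd /=; rewrite inordK ?led.
Qed.

Definition deg (T : finType) (e : rel T) (x : T) : nat := #|[set y | e x y]|.

(* All parts are positive, so the vertices may be taken to be 'I_(size d); the
   adjacency relation is an ffun so that the existential is decidable.
   graphicalP gives the unrestricted form over arbitrary finite simple graphs. *)
Definition graphical (d : seq nat) : bool :=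
  [exists e : {ffun 'I_(size d) * 'I_(size d) -> bool},
    [&& [forall x, forall y, e (x, y) == e (y, x)],
        [forall x, ~~ e (x, x)]
      & perm_eq d [seq deg (fun u v => e (u, v)) x | x : 'I_(size d)]]].

Lemma graphicalP (d : seq nat) :
  reflect (exists (T : finType) (e : rel T),
             [/\ symmetric e, irreflexive e
               & perm_eq d [seq deg e x | x : T]])
          (graphical d).
Proof.
apply: (iffP existsP) => [[e /and3P[/'forall_forallP sye /forallP ire pe]]|].
  exists 'I_(size d), (fun u v => e (u, v)); split=> //.
  - by move=> x y; apply/eqP/sye.
  - by move=> x; apply/negbTE/ire.
move=> [T [e [sye ire pe]]].
have cT : size d = #|T| by rewrite (perm_size pe) size_map -cardE.
pose h (x : 'I_(size d)) : T := enum_val (cast_ord cT x).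
have hb : bijective h.
  exists (fun t => cast_ord (esym cT) (enum_rank t)) => x.
  - by rewrite /h enum_valK cast_ordK.
  - by rewrite /h cast_ordKV enum_rankK.
exists [ffun p => e (h p.1) (h p.2)]; apply/and3P; split.
- by apply/'forall_forallP => x y; rewrite !ffunE /= sye.
- by apply/forallP => x; rewrite ffunE /= ire.
apply: (perm_trans pe).
have degh x : deg (fun u v => [ffun p => e (h p.1) (h p.2)] (u, v)) x
            = deg e (h x).
  rewrite /deg -(card_imset _ (bij_inj hb)); apply: eq_card => t.
  have [h' hK h'K] := hb.
  rewrite -[t]h'K (mem_imset _ _ (bij_inj hb)) !inE ffunE /=; by rewrite h'K.
rewrite /image_mem (eq_map degh) (map_comp (deg e) h); apply: perm_map.
apply: uniq_perm; first exact: enum_uniq.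
  by rewrite (map_inj_uniq (bij_inj hb)) enum_uniq.
have [h' hK h'K] := hb.
by move=> t; rewrite mem_enum inE -[t]h'K map_f ?mem_enum.
Qed.

(* Rows and columns are indexed from 0: index m here is index m.+1 in the usual
   notation, so d_{m+1} is nth 0 d m. *)
Definition frob_len (d : seq nat) : nat :=
  \sum_(0 <= m < size d) (m.+1 <= nth 0 d m).

(* The subtraction does not truncate when m < frob_len d. *)
Definition frob_a (d : seq nat) (m : nat) : nat := nth 0 d m - m.+1.

(* Cell (i, m) belongs to the Ferrers diagram iff m < nth 0 d i. *)
Definition frob_b (d : seq nat) (m : nat) : nat :=
  \sum_(m.+1 <= i < size d) (m < nth 0 d i).

Definition frob_sum_cond (d : seq nat) : bool :=
  frob_len d + \sum_(m < frob_len d) frob_a d m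
    <= \sum_(m < frob_len d) frob_b d m.

Definition frob_pointwise_cond (d : seq nat) : bool :=
  [forall m : 'I_(frob_len d),
    ((frob_a d m)%:Z - (frob_b d m)%:Z <= -1)%R].

Definition p (n : nat) : nat := count_partitions n xpredT.
Definition g (n : nat) : nat := count_partitions n graphical.
Definition f (n : nat) : nat := count_partitions n frob_sum_cond.
Definition f' (n : nat) : nat := count_partitions n frob_pointwise_cond.

(* Main.v *)
(** Put [c m = b m + m + 1], the height of column [m] of the Ferrers diagram.
    Since [\sum_(m < r) c m = \sum_i minn (d i) r], the inequality
    [k + \sum a <= \sum b] is exactly the Erdos-Gallai inequality at the Durfee
    index [k], which every graphical partition satisfies. Conversely, summing the
    pointwise condition over [m < r] gives the Erdos-Gallai inequalities at all
    [r <= k]; those at [r > k] follow from the one at [k]. Sufficiency of the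
    Erdos-Gallai inequalities is proved by Choudum's induction: lower by one the
    last part and the end of the initial constant block, realize the result, and
    reinsert the edge, by an edge switch if it is already present. *)

Require Import Defs.
From mathcomp Require Import all_boot.
From mathcomp Require Import zify.

Set Implicit Arguments.
Unset Strict Implicit.
Unset Printing Implicit Defensive.

(** * Edge toggles and edge switches in simple graphs *)

Section Toggle.

Variable T : finType.
Implicit Types (e : rel T) (d : T -> nat) (x y u v : T).

Lemma degE e x : deg e x = \sum_y (e x y : nat).
Proof. by rewrite /deg -sum1dep_card big_mkcond; apply: eq_bigr => y _; case: e. Qed.

Definition toggle u v e : rel T :=
  fun x y => e x y (+) ((x == u) && (y == v) || (x == v) && (y == u)).

Lemma toggle_sym u v e : symmetric e -> symmetric (toggle u v e).
Proof.
by move=> sye x y; rewrite /toggle sye orbC; congr (_ (+) (_ || _)); rewrite andbC.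
Qed.

Lemma toggle_irr u v e : u != v -> irreflexive e -> irreflexive (toggle u v e).
Proof.
move=> uv ire x; rewrite /toggle ire /=.
by have [->|] := eqVneq x u; rewrite ?(negPf uv) //= andbF.
Qed.

(** A deleted edge is compensated on the left and an inserted one on the right, so one formula
    without truncated subtraction serves both. *)
Lemma deg_toggle u v e x : u != v -> symmetric e ->
  deg (toggle u v e) x + e u v * ((x == u) + (x == v))
    = deg e x + ~~ e u v * ((x == u) + (x == v)).
Proof.
move=> uv sye.
have sum1 z : \sum_y (y == z : nat) = 1.
  by rewrite (bigD1 z) //= eqxx big1 // => y /negPf->.
have sumE : (x == u) + (x == v)
    = \sum_y ((x == u) * (y == v) + (x == v) * (y == u)).
  by rewrite big_split /= -!big_distrr /= !sum1 !muln1.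
rewrite sumE !degE !big_distrr /= -!big_split /=; apply: eq_bigr => y _.
rewrite /toggle.
have [->|xu] /= := eqVneq x u.
  rewrite (negPf uv) /= orbF; have [->|yv] /= := eqVneq y v; last by rewrite addbF; lia.
  by case: (e u v).
have [->|xv] /= := eqVneq x v; last by rewrite addbF; lia.
have [->|yu] /= := eqVneq y u; last by rewrite addbF; lia.
by rewrite (sye v); case: (e u v).
Qed.

(** Otherwise the neighbours of [m] other than [l] are all neighbours of [l] other than [m]. Since
    [e m l] and [e l m] agree, [deg e m <= deg e l] would follow. *)
Lemma exists_private_neighbor e (m l : T) : symmetric e -> irreflexive e ->
  m != l -> deg e l < deg e m -> exists2 w, e m w & (w != l) && ~~ e l w.
Proof.
move=> sye ire ml ltd; apply/exists_inP; apply: contraLR ltd => /exists_inPn H.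
rewrite -leqNgt /deg (cardsD1 l [set y | e m y]) (cardsD1 m [set y | e l y]).
rewrite !inE sye leq_add2l; apply: subset_leq_card.
apply/subsetP=> w; rewrite !inE => /andP[wl emw].
have := H w emw; rewrite wl /= negbK => ->; rewrite andbT.
by apply: contraTneq emw => ->; rewrite ire.
Qed.

(** Undoes the Choudum reduction. If [t l] is already an edge, [t] has only [d t - 1] neighbours,
    too few to cover [S :\ t]; a non-neighbour [m] there satisfies [deg e m = d m >= d l > deg e l],
    which makes the switch possible. *)
Lemma realize_add_pair e d (t l : T) (S : {set T}) :
    symmetric e -> irreflexive e -> t != l ->
    (forall x, d x = deg e x + (x == t) + (x == l)) ->
    t \in S -> (forall x, x \in S -> d l <= d x) -> d t < #|S| ->
  exists e' : rel T, [/\ symmetric e', irreflexive e' & deg e' =1 d].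
Proof.
move=> sye ire tl dE tS Sl dt.
have [etl|netl] := boolP (e t l); last first.
  exists (toggle t l e); split; first exact: toggle_sym.
    exact: toggle_irr.
  by move=> x; rewrite dE; have := deg_toggle x tl sye; rewrite (negPf netl); lia.
(* A non-neighbour [m] of [t] in [S] has a neighbour [w] not adjacent to [l]:
   replace the edge [m w] by the edges [t m] and [w l]. *)
have [m mS netm] : exists2 m, m \in S :\ t & ~~ e t m.
  have : ~~ (S :\ t \subset [set y | e t y]).
    apply: contraL dt => /subset_leq_card; rewrite -/(deg e t) => le.
    by have := dE t; rewrite eqxx (negPf tl) (cardsD1 t S) tS -leqNgt; lia.
  by case/subsetPn=> m mS; rewrite inE; exists m.
move: mS; rewrite !inE => /andP[mt mS].
have ml : m != l by apply: contraNneq netm => ->.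
have [w emw /andP[wl nelw]] : exists2 w, e m w & (w != l) && ~~ e l w.
  apply: exists_private_neighbor => //; have := Sl m mS; rewrite !dE.
  by rewrite eqxx (negPf mt) (negPf ml); lia.
have wm : w != m by apply: contraTneq emw => ->; rewrite ire.
have wt : w != t by apply: contraTneq emw => ->; rewrite sye.
have mw : m != w by rewrite eq_sym.
have tm : t != m by rewrite eq_sym.
have tw : t != w by rewrite eq_sym.
pose e1 := toggle m w e; pose e2 := toggle t m e1.
have sy1 : symmetric e1 by exact: toggle_sym.
have sy2 : symmetric e2 by exact: toggle_sym.
exists (toggle w l e2); split; first exact: toggle_sym.
  by do 3 apply: toggle_irr => //.
move=> x; rewrite dE.
have := deg_toggle x wl sy2; have := deg_toggle x tm sy1.
have := deg_toggle x mw sye; rewrite emw -/e1 -/e2.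
have -> : e1 t m = false by rewrite /e1 /toggle (negPf netm) (negPf tm) (negPf tw).
have -> : e2 w l = false.
  rewrite /e2 /e1 /toggle sye (negPf nelw) (negPf wm) (negPf wt) /=.
  by rewrite (eq_sym l) (negPf ml) andbF.
rewrite /= !(mul0n, mul1n, addn0).
move: (nat_of_bool (x == t)) (nat_of_bool (x == l)).
by move: (nat_of_bool (x == m)) (nat_of_bool (x == w)); clear; lia.
Qed.

End Toggle.

(** * Erdos-Gallai inequalities under the Choudum reduction *)

Definition erdos_gallai_at (N : nat) (d : nat -> nat) (r : nat) : bool :=
  \sum_(0 <= i < r) d i <= r * r.-1 + \sum_(r <= i < N) minn (d i) r.

Lemma sum_nat_eq1 (m n j : nat) : \sum_(m <= i < n) (i == j : nat) = (m <= j < n).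
Proof.
have [mn|nm] := leqP m n; last by rewrite big_geq //; lia.
elim: n mn => [|n IHn]; first by rewrite leqn0 => /eqP->; rewrite big_geq //; lia.
rewrite leq_eqVlt => /orP[/eqP->|mn]; first by rewrite big_geq //; lia.
by rewrite big_nat_recr //= IHn //; lia.
Qed.

Section ChoudumStep.

Variables (N : nat) (d : nat -> nat) (t L : nat).
Hypothesis d_le : forall i j, i <= j -> d j <= d i.
Hypothesis d_even : ~~ odd (\sum_(0 <= i < N) d i).
Hypothesis EG : forall r, r <= N -> erdos_gallai_at N d r.
Hypothesis (t_lt : t < L) (L_lt : L < N).
Hypothesis (d_const : forall i, i <= t -> d i = d 0) (dL_gt0 : 0 < d L).

Let d1 i := d i - (i == t) - (i == L).

(** The left side loses at least one, at [t]; the right side loses at most one, at [L]. *)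
Lemma choudum_step_late r : t < r -> r <= N -> erdos_gallai_at N d1 r.
Proof.
move=> tr rN; have := EG rN; rewrite /erdos_gallai_at.
have le1 : \sum_(0 <= i < r) d1 i + \sum_(0 <= i < r) (i == t) <= \sum_(0 <= i < r) d i.
  rewrite -big_split /=; apply: leq_sum => i _; rewrite /d1.
  have [->|_] := eqVneq i t; last lia.
  have : d L <= d t by apply: d_le; lia.
  by lia.
have le2 : \sum_(r <= i < N) minn (d i) r
    <= \sum_(r <= i < N) minn (d1 i) r + \sum_(r <= i < N) (i == L).
  rewrite -big_split /= !big_nat; apply: leq_sum => i /andP[ri _]; rewrite /d1.
  have -> : (i == t) = false by lia.
  by lia.
by move: le1 le2; rewrite !sum_nat_eq1; lia.
Qed.

Lemma choudum_prefix r : r <= t -> \sum_(0 <= i < r) d1 i = r * d 0.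
Proof.
move=> rt; rewrite big_nat (eq_bigr (fun=> d 0)).
  by rewrite -big_nat sum_nat_const_nat subn0.
move=> i /andP[_ ir]; rewrite /d1 d_const; last lia.
by lia.
Qed.

(** The tail of [d1] must have sum at least [r]. The total of [d] is [r * r + r] plus the entries
    after [r]; by parity these have an even sum, positive because of [d L], hence at least 2. This
    pays for the two units removed. *)
Lemma choudum_step_diag r : r <= t -> d 0 = r -> erdos_gallai_at N d1 r.
Proof.
move=> rt d0r; rewrite /erdos_gallai_at choudum_prefix // d0r.
have [->//|r0] := posnP r.
suff : r <= \sum_(r <= i < N) minn (d1 i) r by nia.
have -> : \sum_(r <= i < N) minn (d1 i) r = \sum_(r <= i < N) d1 i.
  by apply: eq_bigr => i _; apply/minn_idPl; rewrite /d1; have := d_le (leq0n i); lia.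
have le2 : \sum_(r <= i < N) d i <=
    \sum_(r <= i < N) d1 i + \sum_(r <= i < N) (i == t) + \sum_(r <= i < N) (i == L).
  by rewrite -!big_split /=; apply: leq_sum => i _; rewrite /d1; lia.
have rN : r < N by lia.
have dr : d r = r by rewrite d_const.
have X0 : d L <= \sum_(r.+1 <= i < N) d i.
  rewrite (big_cat_nat (n := L)) //=; [|lia|lia].
  by rewrite [X in _ + X]big_ltn //; lia.
have head : \sum_(0 <= i < r) d i = r * r.
  rewrite big_nat (eq_bigr (fun=> r)); first by rewrite -big_nat sum_nat_const_nat subn0.
  by move=> i /andP[_ ir]; rewrite d_const //; lia.
move: d_even; rewrite (big_cat_nat (leq0n r) (ltnW rN)) /= head.
move: le2; rewrite !(big_ltn rN) dr !sum_nat_eq1 !oddD oddM andbb addbA addbb /=.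
by case X : (\sum_(r.+1 <= i < N) d i) X0 => [|[|x]]; lia.
Qed.

Lemma choudum_step_early r : r <= t -> r < d 0 -> erdos_gallai_at N d1 r.
Proof.
move=> rt rd; rewrite /erdos_gallai_at choudum_prefix //.
have tN : t.+1 <= N by lia.
have -> : \sum_(r <= i < N) minn (d1 i) r
    = (t.+1 - r) * r + \sum_(t.+1 <= i < N) minn (d1 i) r.
  rewrite (big_cat_nat (n := t.+1)) //=; last lia.
  congr (_ + _); rewrite big_nat (eq_bigr (fun=> r)).
    by rewrite -big_nat sum_nat_const_nat.
  by move=> i /andP[ri it]; rewrite /d1 d_const //; lia.
pose S := \sum_(t.+1 <= i < N) minn (d i) r.
pose q := \sum_(t.+1 <= i < N) (r < d i).
have headE s : s <= t.+1 -> \sum_(0 <= i < s) d i = s * d 0.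
  move=> st; rewrite big_nat (eq_bigr (fun=> d 0)).
    by rewrite -big_nat sum_nat_const_nat subn0.
  by move=> i /andP[_ ?]; rewrite d_const //; lia.
have blockE s : s <= t.+1 -> s <= d 0 -> \sum_(s <= i < N) minn (d i) s
    = (t.+1 - s) * s + \sum_(t.+1 <= i < N) minn (d i) s.
  move=> st sd; rewrite (big_cat_nat (n := t.+1)) //=.
  congr (_ + _); rewrite big_nat (eq_bigr (fun=> s)).
    by rewrite -big_nat sum_nat_const_nat.
  by move=> i /andP[ri it]; rewrite d_const //; lia.
(* If [d L > r], truncation at [r] hides both decrements. Otherwise one unit may be lost at [L], so
   a strict inequality for [d] is needed; it comes from the inequality at [r.+1]. *)
have [dLr|dLr] := leqP (d L) r; last first.
  have -> : \sum_(t.+1 <= i < N) minn (d1 i) r = S.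
    rewrite /S !big_nat; apply: eq_bigr => i /andP[ti _]; rewrite /d1.
    have -> : (i == t) = false by lia.
    by have [->|_] := eqVneq i L; lia.
  have rN : r <= N by lia.
  by have := EG rN; rewrite /erdos_gallai_at headE ?blockE -/S //; lia.
have leS : S <= \sum_(t.+1 <= i < N) minn (d1 i) r + 1.
  have <- : \sum_(t.+1 <= i < N) (i == L : nat) = 1 by rewrite sum_nat_eq1; lia.
  rewrite /S -big_split /= !big_nat; apply: leq_sum => i /andP[ti _]; rewrite /d1.
  have -> : (i == t) = false by lia.
  by lia.
have Sq : \sum_(t.+1 <= i < N) minn (d i) r.+1 = S + q.
  by rewrite -big_split /=; apply: eq_bigr => i _; lia.
have [->|r0] := posnP r; first by lia.
(* Each entry counted by [q] contributes [r] to [S], and position [L], not counted since [d L <= r],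
   contributes at least 1. *)
have ltS : r * q + 1 <= S.
  have <- : \sum_(t.+1 <= i < N) (i == L : nat) = 1 by rewrite sum_nat_eq1; lia.
  rewrite /S /q big_distrr -big_split /=; apply: leq_sum => i _.
  by have [->|_] := eqVneq i L; case: ltnP => /=; lia.
have r1N : r.+1 <= N by lia.
have := EG r1N; rewrite /erdos_gallai_at headE ?blockE ?Sq //=.
(* If the inequality failed, [x = d 0 - t] would satisfy [r x >= S] and
   [(r + 1) x <= S + q], so [x <= q] and [S <= r q]. *)
move=> EG1.
have {}EG1 : r.+1 * d 0 <= r.+1 * t + S + q by nia.
suff : r * d 0 < r * t + S.
  have : r * r.-1 + (t.+1 - r) * r = r * t.
    by rewrite [_ * r]mulnC -mulnDr; congr (_ * _); lia.
  by lia.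
rewrite ltnNge; apply/negP => bad.
have dq : d 0 <= t + q by lia.
have : r * d 0 <= r * (t + q) by rewrite leq_mul2l dq orbT.
by rewrite mulnDr; lia.
Qed.

Lemma choudum_step r : r <= N -> erdos_gallai_at N d1 r.
Proof.
move=> rN; have [tr|rt] := ltnP t r; first exact: choudum_step_late.
have [dr|rd|dr] := ltngtP (d 0) r; last exact: choudum_step_diag.
  (* Here [d 0 <= r.-1], so the term [r * r.-1] suffices. *)
  rewrite /erdos_gallai_at choudum_prefix //.
  by apply: leq_trans (leq_addr _ _); rewrite leq_mul2l; lia.
exact: choudum_step_early.
Qed.

End ChoudumStep.

(** * Sufficiency of the Erdos-Gallai inequalities *)

Theorem erdos_gallai_sufficient (N : nat) (d : nat -> nat) :
    (forall i j, i <= j -> d j <= d i) -> (forall i, N <= i -> d i = 0) ->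
    ~~ odd (\sum_(0 <= i < N) d i) ->
    (forall r, r <= N -> erdos_gallai_at N d r) ->
  exists e : rel 'I_N,
    [/\ symmetric e, irreflexive e & forall x, deg e x = d x].
Proof.
have [s] := ubnP (\sum_(0 <= i < N) d i).
elim: s d => // s IHs d les d_le d_out d_even EG.
have [d0|d0] := posnP (d 0).
  exists (fun _ _ => false); split=> // x.
  rewrite degE big1 //; have := d_le 0 x; lia.
have exL : exists i, 0 < d i by exists 0.
have ubL i : 0 < d i -> i <= N.
  by move=> di; rewrite leqNgt; apply/negP => /ltnW/d_out; lia.
have [L dL maxL] := ex_maxnP exL ubL.
have LN : L < N by rewrite ltnNge; apply/negP => /d_out; lia.
(* The inequality at 1 bounds [d 0] by the number of positive entries after the first. This later
   gives [d t < #|S|]. *)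
have d0L : d 0 <= L.
  have := EG 1 (leq_ltn_trans (leq0n _) LN); rewrite /erdos_gallai_at big_nat1 mul1n.
  rewrite (big_cat_nat (n := L.+1)) //=.
  have -> : \sum_(L.+1 <= i < N) minn (d i) 1 = 0.
    by rewrite big_nat big1 // => i /andP[Li _]; have := maxL i; lia.
  rewrite addn0 => /leq_trans; apply.
  apply: (@leq_trans (\sum_(1 <= i < L.+1) 1)); first by apply: leq_sum => i _; lia.
  by rewrite sum_nat_const_nat; lia.
(* Keeping [t] strictly before [L] covers a constant positive part: then [t] is [L.-1], and lowering
   both positions preserves monotonicity. *)
have ext : exists i, (i < L) && (d i == d 0) by exists 0; lia.
have ubt i : (i < L) && (d i == d 0) -> i <= L by lia.
have [t /andP[tL /eqP dt] maxt] := ex_maxnP ext ubt.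
have d_const i : i <= t -> d i = d 0.
  by move=> it; apply/eqP; rewrite eqn_leq d_le //= -dt d_le.
pose d1 i := d i - (i == t) - (i == L).
have d1E i : d i = d1 i + (i == t) + (i == L).
  rewrite /d1; have [->|_] := eqVneq i t; first by lia.
  by have [->|_] := eqVneq i L; lia.
have sumE : \sum_(0 <= i < N) d i = (\sum_(0 <= i < N) d1 i) + 2.
  rewrite (eq_bigr _ (fun i _ => d1E i)) !big_split /= !sum_nat_eq1; lia.
have tN : t < N by lia.
have [|||||e [sye ire dege]] := IHs d1; first by lia.
- move=> i j ij; rewrite /d1.
  have := d_le _ _ ij; have [it|it] := eqVneq i t; last first.
    have [iL|iL] := eqVneq i L; last lia.
    by have := maxL j; lia.
  have [jt|jt] := eqVneq j t; first by lia.
  have [jL|jL] := eqVneq j L; first by lia.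
  by have := maxt j; have := maxL j; rewrite it dt; lia.
- by move=> i /d_out; rewrite /d1; lia.
- by move: d_even; rewrite sumE; lia.
- exact: choudum_step.
(* These are the vertices of positive degree, among which [L] has the smallest. *)
pose S := [set x : 'I_N | x <= L].
have cS : #|S| = L.+1.
  rewrite -sum1dep_card big_mkcond /=.
  rewrite -(big_mkord xpredT (fun i => if i <= L then 1 else 0)).
  rewrite (big_cat_nat (n := L.+1)) //= big_nat (eq_bigr (fun=> 1)) => [|i /andP[_]]; last first.
    by rewrite ltnS => ->.
  rewrite -big_nat sum_nat_const_nat big_nat big1 => [|i /andP[Li _]]; last first.
    by rewrite leqNgt Li.
  by lia.
have [] := @realize_add_pair _ e (fun x => d x) (Ordinal tN) (Ordinal LN) S sye ire.
- by rewrite -val_eqE /=; lia.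
- by move=> x; rewrite dege d1E -!val_eqE.
- by rewrite inE /=; lia.
- by move=> x; rewrite inE => xL; apply: d_le.
- by rewrite cS /= dt; lia.
by move=> e' [sy' ir' dg']; exists e'.
Qed.

(** * Frobenius coordinates and column heights *)

Lemma nth_sorted_geq (s : seq nat) : sorted geq s ->
  forall i j, i <= j -> nth 0 s j <= nth 0 s i.
Proof.
move=> ss i j ij; have [sj|js] := leqP (size s) j; first by rewrite nth_default.
apply: (sorted_leq_nth _ _ 0 ss) => //; rewrite ?inE.
- by move=> a b c; rewrite /geq /=; lia.
- by move=> a; rewrite /geq /=.
- by lia.
Qed.

(** The indices satisfying [P] form an initial segment. This turns [frob_len], defined as a count,
    into a threshold. *)
Lemma sum_down_closed (P : pred nat) (n m : nat) :
    (forall i j, i <= j -> P j -> P i) -> m < n ->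
  (m < \sum_(0 <= i < n) (P i : nat)) = P m.
Proof.
move=> dP; elim: n => // n IHn; rewrite ltnS leq_eqVlt => mn.
have le k : \sum_(0 <= i < k) (P i : nat) <= k.
  by rewrite -[X in _ <= X]muln1 -[X in X * 1]subn0 -sum_nat_const_nat; apply: leq_sum => i; lia.
have all1 : P n -> \sum_(0 <= i < n) (P i : nat) = n.
  move=> Pn; rewrite big_nat (eq_bigr (fun=> 1)) => [|i /andP[_ ilt]].
    by rewrite -big_nat sum_nat_const_nat; lia.
  by rewrite (dP i n) //; lia.
rewrite big_nat_recr //=; case: (boolP (P n)) => [Pn|nPn].
  by rewrite all1 // (dP m n) //; lia.
rewrite addn0; case/orP: mn => [/eqP->|/IHn//].
by have := le n; rewrite (negPf nPn); lia.
Qed.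

Lemma sum_ltn_minn (r x : nat) : \sum_(0 <= m < r) (m < x : nat) = minn x r.
Proof.
elim: r => [|r IHr]; first by rewrite big_geq // minn0.
by rewrite big_nat_recr //= IHr; case: ltnP => rx; lia.
Qed.

Section Frobenius.

Variable s : seq nat.
Hypothesis s_sorted : sorted geq s.

Let N := size s.
Let d := nth 0 s.
Let k := frob_len s.

Lemma frob_len_le_size : k <= N.
Proof.
rewrite /k /frob_len -[X in _ <= X]muln1 -[X in X * 1]subn0 -sum_nat_const_nat.
by apply: leq_sum => i; lia.
Qed.

Lemma lt_frob_len m : m < N -> (m < k) = (m < d m).
Proof.
move=> mN; rewrite /k /frob_len (@sum_down_closed (fun m => m < nth 0 s m)) //.
by move=> i j ij; have := nth_sorted_geq s_sorted ij; lia.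
Qed.

Lemma frob_len_le_nth i : i < k -> k <= d i.
Proof.
move=> ik; have kN := frob_len_le_size.
have := @lt_frob_len k.-1; have /(_ i k.-1) := nth_sorted_geq s_sorted.
by rewrite -/d; lia.
Qed.

Lemma nth_le_frob_len i : k <= i -> d i <= k.
Proof.
move=> ki; apply: leq_trans (nth_sorted_geq s_sorted ki) _.
have [Nk|kN] := leqP N k; first by rewrite nth_default.
by have := lt_frob_len kN; rewrite /d; lia.
Qed.

(** The first [m.+1] rows have length at least [k > m], so each meets column [m]. *)
Lemma frob_bE m : m < k -> frob_b s m + m.+1 = \sum_(0 <= i < N) (m < d i : nat).
Proof.
move=> mk; have kN := frob_len_le_size.
rewrite (big_cat_nat (n := m.+1)) //=; last lia.
rewrite addnC; congr (_ + _).
rewrite big_nat (eq_bigr (fun=> 1)) => [|i im].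
  by rewrite -big_nat sum_nat_const_nat; lia.
by have := @frob_len_le_nth i; lia.
Qed.

Lemma frob_aE m : m < k -> frob_a s m + m.+1 = d m.
Proof. by move=> mk; have := frob_len_le_nth mk; rewrite /frob_a -/d; lia. Qed.

(** The cells in the first [r] columns are counted by columns and by rows; each of the first [r]
    rows contributes [r]. *)
Lemma sum_frob_b r : r <= k ->
  \sum_(0 <= m < r) (frob_b s m + m.+1) = r * r + \sum_(r <= i < N) minn (d i) r.
Proof.
move=> rk; have kN := frob_len_le_size.
have -> : \sum_(0 <= m < r) (frob_b s m + m.+1)
    = \sum_(0 <= m < r) \sum_(0 <= i < N) (m < d i : nat).
  by rewrite !big_nat; apply: eq_bigr => m mr; apply: frob_bE; lia.
rewrite exchange_big /= (eq_bigr _ (fun i _ => sum_ltn_minn r (d i))).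
rewrite (big_cat_nat (n := r)) //=; last lia.
congr (_ + _); rewrite big_nat (eq_bigr (fun=> r)) => [|i ir].
  by rewrite -big_nat sum_nat_const_nat subn0.
by have := @frob_len_le_nth i; lia.
Qed.

(** Adding the sum of [i.+1] over [i < k] to both sides turns arms into row lengths and legs into
    column heights; the extra [k] absorbs [k * k - k * k.-1]. *)
Lemma frob_sum_condE : frob_sum_cond s = erdos_gallai_at N d k.
Proof.
rewrite /frob_sum_cond /erdos_gallai_at -/k.
rewrite -(big_mkord xpredT (frob_a s)) -(big_mkord xpredT (frob_b s)).
have := sum_frob_b (leqnn k).
have -> : \sum_(0 <= i < k) d i = \sum_(0 <= i < k) (frob_a s i + i.+1).
  by rewrite !big_nat; apply: eq_bigr => m mk; rewrite frob_aE; lia.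
rewrite !big_split /= => sumb.
have : k * k = k * k.-1 + k by case: (k) => //= j; lia.
by move=> kk; apply/idP/idP; lia.
Qed.

Lemma pointwise_erdos_gallai : frob_pointwise_cond s ->
  forall r, r <= N -> erdos_gallai_at N d r.
Proof.
move=> /forallP pw; have kN := frob_len_le_size.
(* The pointwise condition says that row [m] is strictly shorter than column [m]. *)
have low r : r <= k -> erdos_gallai_at N d r.
  move=> rk; rewrite /erdos_gallai_at.
  suff : \sum_(0 <= i < r) d i + \sum_(0 <= i < r) 1
      <= r * r + \sum_(r <= i < N) minn (d i) r.
    by rewrite sum_nat_const_nat; case: (r) => //= j; lia.
  rewrite -sum_frob_b // -big_split /= !big_nat; apply: leq_sum => i /andP[_ ir].
  have ik : i < k by lia.
  by have := pw (Ordinal ik); rewrite -frob_aE //=; lia.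
(* Rows from [k] on have length at most [k], so neither truncation cuts them. Passing from [k] to
   [r] moves rows [k] to [r.-1] across the inequality, costing at most [2 * ((r - k) * k)], which
   the growth of [r * r.-1] covers. *)
move=> r rN; have [|kr] := leqP r k; first exact: low.
have := low k (leqnn k); rewrite /erdos_gallai_at.
have kr' := ltnW kr.
have -> : \sum_(k <= i < N) minn (d i) k
    = \sum_(k <= i < r) d i + \sum_(r <= i < N) d i.
  rewrite -big_cat_nat //= !big_nat; apply: eq_bigr => i /andP[ki _].
  by have := nth_le_frob_len ki; lia.
have -> : \sum_(r <= i < N) minn (d i) r = \sum_(r <= i < N) d i.
  rewrite !big_nat; apply: eq_bigr => i /andP[ri _].
  by have := nth_le_frob_len (leq_trans kr' ri); lia.
have leX : \sum_(k <= i < r) d i <= (r - k) * k.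
  rewrite -sum_nat_const_nat !big_nat; apply: leq_sum => i /andP[ki _].
  exact: nth_le_frob_len.
rewrite (big_cat_nat (leq0n k) kr') /=.
have : k * k.-1 + 2 * ((r - k) * k) <= r * r.-1.
  have aux i j : i * i.-1 + 2 * (j * i) <= (i + j) * (i + j).-1.
    have sq x : x * x.-1 + x = x * x by case: x => //= x; lia.
    have := sq i; have := sq (i + j).
    have : j <= j * j by case: j => // j; rewrite leq_pmulr.
    by lia.
  by have := aux k (r - k); rewrite subnKC.
by lia.
Qed.

Lemma pointwise_graphical : ~~ odd (sumn s) -> frob_pointwise_cond s -> graphical s.
Proof.
move=> s_even pw; apply/graphicalP.
have [||||e [sye ire dege]] := @erdos_gallai_sufficient N d.
- exact: nth_sorted_geq.
- by move=> i; apply: nth_default.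
- by rewrite -(big_nth 0 xpredT id) -sumnE.
- exact: pointwise_erdos_gallai.
exists 'I_N, e; split=> //.
suff -> : [seq deg e x | x : 'I_N] = s by [].
rewrite /image_mem (eq_map dege) -[in RHS](mkseq_nth 0 s) /mkseq -val_enum_ord.
by rewrite -map_comp.
Qed.

End Frobenius.

(** * Necessity of the Erdos-Gallai inequalities *)

Lemma erdos_gallai_necessary (s : seq nat) (r : nat) :
  graphical s -> r <= size s -> erdos_gallai_at (size s) (nth 0 s) r.
Proof.
move=> /graphicalP[T [e [sye ire]]] pe rs.
(* [x0] serves as default vertex for [nth]; without vertices [r] is 0. *)
have [x0 _|T0] := pickP (mem T); last first.
  have sz : size s = 0 by rewrite (perm_size pe) size_map -cardE; apply: eq_card0.
  by move: rs; rewrite sz leqn0 => /eqP->; rewrite /erdos_gallai_at big_geq.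
(* The degrees match [s] only up to permutation, so the vertices are listed in the order of [s]. *)
have [vs pvs sE] : exists2 vs, perm_eq vs (enum T) & s = map (deg e) vs.
  have /(perm_iotaP 0)[Is pIs ->] := pe.
  exists [seq nth x0 (enum T) i | i <- Is].
    rewrite -[X in perm_eq _ X](mkseq_nth x0) /mkseq; apply: perm_map.
    by rewrite size_map in pIs.
  rewrite -map_comp; apply/eq_in_map => i; rewrite (perm_mem pIs) mem_iota add0n => /andP[_ ilt].
  by rewrite (nth_map x0) // -(size_map (deg e)).
have uvs : uniq vs by rewrite (perm_uniq pvs) enum_uniq.
have svs : size vs = size s by rewrite sE size_map.
pose K := take r vs; pose R := drop r vs.
have sumT (F : T -> nat) : \sum_x F x = \sum_(x <- K) F x + \sum_(x <- R) F x.
  rewrite -big_cat cat_take_drop (perm_big _ pvs) /= big_enum //.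
rewrite /erdos_gallai_at.
have nthE i : i < size s -> nth 0 s i = deg e (nth x0 vs i).
  by move=> si; rewrite sE (nth_map x0) // svs.
have szK : size K = r by rewrite size_takel // svs.
have -> : \sum_(0 <= i < r) nth 0 s i = \sum_(x <- K) deg e x.
  rewrite (big_nth x0) szK !big_nat; apply: eq_bigr => i ir.
  by rewrite nth_take ?nthE //; lia.
have -> : \sum_(r <= i < size s) minn (nth 0 s i) r = \sum_(x <- R) minn (deg e x) r.
  rewrite (big_nth x0) size_drop svs -{1}[r]add0n big_addn.
  by rewrite !big_nat; apply: eq_bigr => i ir; rewrite nth_drop nthE addnC //; lia.
have -> : \sum_(x <- K) deg e x
    = \sum_(x <- K) \sum_(y <- K) (e x y : nat) + \sum_(y <- R) \sum_(x <- K) (e x y : nat).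
  rewrite [X in _ = _ + X]exchange_big -big_split /=.
  by apply: eq_bigr => x _; rewrite degE sumT.
have uK : uniq K by apply: take_uniq.
(* Ordered adjacent pairs inside [K] number at most [r * r.-1], and each [y] in [R] has at most
   [minn (deg e y) r] neighbours in [K]. *)
apply: leq_add.
  have -> : r * r.-1 = \sum_(x <- K) r.-1.
    by rewrite big_const_seq count_predT szK iter_addn_0 mulnC.
  rewrite big_seq [X in _ <= X]big_seq; apply: leq_sum => x xK.
  rewrite (bigD1_seq x) //= ire add0n.
  have -> : r.-1 = \sum_(y <- K | y != x) 1.
    rewrite sum1_count -szK -(count_predC (pred1 x) K) count_uniq_mem // xK.
    by apply: eq_count.
  by apply: leq_sum => y _; case: (e x y).
apply: leq_sum => y _; rewrite leq_min; apply/andP; split.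
  rewrite degE sumT; apply: leq_trans (leq_addr _ _).
  by apply: leq_sum => x _; rewrite sye.
have -> : r = \sum_(x <- K) 1.
  by rewrite sum1_size szK.
by apply: leq_sum => x _; case: (e x y).
Qed.

(** * Comparison of the counting functions *)

Lemma count_partitions_le (n : nat) (P Q : pred (seq nat)) :
    (forall d, is_partition n d -> P d -> Q d) ->
  count_partitions n P <= count_partitions n Q.
Proof.
move=> PQ; apply: subset_leq_card; apply/subsetP => s; rewrite !inE.
by case/andP=> pn Ps; rewrite pn PQ.
Qed.

Theorem mainTheorem1 (n : nat) (n_gt0 : 0 < n) (n_even : ~~ odd n) :
  [/\ f' n <= g n, g n <= f n & f n <= p n].
Proof.
split; apply: count_partitions_le => // d /and3P[ds _ /eqP dn].
  by apply: pointwise_graphical; rewrite ?dn.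
by move=> gd; rewrite frob_sum_condE // erdos_gallai_necessary // frob_len_le_size.
Qed.
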